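(* Let $X$ be a locally compact, non-compact Hausdorff space, with one-point compactification $\alpha X = X \cup \{\star\}$. Then $\alpha X$ is radial at $\star$ if and only if for every cofinal $\mathcal{C} \subseteq \overline{\mathbf{Sp}}^\infty(X)$, the union $\bigcup \mathcal{C}$ has co-compact interior in $X$.
   Context: A transfinite sequence is a net whose domain is (nonempty and) well-ordered. A space $Z$ is radial at $z$ if for every $A \subseteq Z$ with $z \in \overline{A}$ there is a transfinite sequence with range in $A$ converging to $z$. A spoke at a point $z$ of $Z$ is a subspace $S \ni z$ of $Z$ such that $z$ has, in $S$, a neighbourhood base well-ordered by $\supseteq$. $\star$ denotes the point at infinity of $\alpha X$. A set $S \subseteq X$ is a spoke at infinity of $X$ if $S \cup \{\star\}$ is a spoke at $\star$ in $\alpha X$; $\overline{\mathbf{Sp}}^\infty(X)$ is the set of spokes at infinity that are closed in $X$. It is quasi-ordered by: $S \le T$ if $S \setminus T$ has compact closure in $X$. $\mathcal{C} \subseteq \overline{\mathbf{Sp}}^\infty(X)$ is cofinal if every $S \in \overline{\mathbf{Sp}}^\infty(X)$ satisfies $S \le T$ for some $T \in \mathcal{C}$. A subset of $X$ is co-compact if its complement in $X$ is compact. *)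

(* Defs.v *)
From HB Require Import structures.
From mathcomp Require Import all_boot all_order.
From mathcomp Require Import boolp classical_sets functions wochoice filter.
From mathcomp Require Import topology_structure compact separation_axioms.
From mathcomp Require Import one_point_compactification.

Set Implicit Arguments.
Unset Strict Implicit.
Unset Printing Implicit Defensive.

Local Open Scope classical_set_scope.

(* The filter of tails of a directed index set: [u @ tails R --> z] is the
   usual convergence of the net [u]. *)
Definition tails (I : Type) (R : rel I) : set_system I :=
  filter_from [set: I] (fun i => [set j | R i j]).

(* [well_order] asks for a unique minimum in every nonempty subset, which makes
   [R] a (reflexive) total order. *)
Definition radial_at (Z : topologicalType) (z : Z) : Prop :=
  forall A : set Z, closure A z ->
    exists (I : Type) (R : rel I) (u : I -> Z),
      [/\ [set: I] !=set0, well_order R, forall i, A (u i)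
        & u @ tails R --> z].

Definition subspace_nbhs (Z : topologicalType) (S : set Z) (z : Z) :
    set (set Z) :=
  [set S `&` U | U in nbhs z].

Definition subspace_nbhs_base (Z : topologicalType) (S : set Z) (z : Z)
    (B : set (set Z)) : Prop :=
  B `<=` subspace_nbhs S z /\
  forall V, subspace_nbhs S z V -> exists2 W, B W & W `<=` V.

Definition rel_supset (Z : Type) : rel (set Z) := fun U V => `[< V `<=` U >].

Definition is_spoke (Z : topologicalType) (z : Z) (S : set Z) : Prop :=
  S z /\
  exists2 B : set (set Z),
    subspace_nbhs_base S z B & wo_chain (@rel_supset Z) (mem B).

(* The points of [one_point_compactification X] are [Some x] for [x : X] and
   [None], the point at infinity. *)
Definition infty (X : topologicalType) : one_point_compactification X := None.

Definition spoke_at_infty (X : topologicalType) (S : set X) : Prop :=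
  is_spoke (infty X)
    ([set (Some x : one_point_compactification X) | x in S] `|` [set infty X]).

Definition closed_spokes_at_infty (X : topologicalType) : set (set X) :=
  [set S | spoke_at_infty S /\ closed S].
Arguments closed_spokes_at_infty : clear implicits.

Definition spoke_le (X : topologicalType) (S T : set X) : Prop :=
  compact (closure (S `\` T)).

Definition cofinal_spokes (X : topologicalType) (C : set (set X)) : Prop :=
  C `<=` closed_spokes_at_infty X /\
  forall S, closed_spokes_at_infty X S -> exists2 T, C T & spoke_le S T.

Definition co_compact (X : topologicalType) (A : set X) : Prop :=
  compact (~` A).

(* Main.v *)
Require Import Defs.
From HB Require Import structures.
From mathcomp Require Import all_boot all_order.
From mathcomp Require Import boolp classical_sets functions wochoice filter.
From mathcomp Require Import topology_structure compact separation_axioms.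
From mathcomp Require Import one_point_compactification.

Set Implicit Arguments.
Unset Strict Implicit.
Unset Printing Implicit Defensive.

Local Open Scope classical_set_scope.

(* If [A] accumulates at infinity but no transfinite sequence in [A] converges
   to infinity, then [A] meets every closed spoke in a relatively compact set.
   Cutting each closed spoke down to a closed neighbourhood of infinity that
   avoids this set gives a cofinal family of spokes disjoint from [A], so the
   interior of its union is not co-compact.

   Conversely, let the space be radial at infinity and let [A], the complement
   of the union of a cofinal family, be not relatively compact.  It suffices to
   find a closed spoke [S] with [S `&` A] not relatively compact.  Well-order
   the space and let [B] be the shortest initial segment of [A] that is not
   relatively compact.  A transfinite sequence [u] in [B] converging to infinity
   eventually leaves each proper initial segment of [B]; let [v b] be the value
   of [u] at the first index from which on [u] stays above [b].  A maximal subset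
   [E] of [B] with [v e <= e'] for all [e < e'] in [E] is unbounded in [B].  Then
   [v] along [E] converges to infinity and its proper initial segments are
   relatively compact, so the closures of its tails form a neighbourhood base at
   infinity in the closure of its range. *)

(** * Well-orders given by unique minima are total orders *)

Section WellOrder.
Context {T : Type} {R : rel T} (woR : well_order R).

Lemma well_order_min (A : set T) :
  A !=set0 -> exists2 m, A m & forall x, A x -> R m x.
Proof.
move=> [a Aa].
have /woR[m [[Am minm] _]] : nonempty [pred x | `[< A x >]].
  by exists a; apply/asboolP.
exists m; first exact/asboolP.
by move=> x Ax; apply: minm; apply/asboolP.
Qed.

Lemma well_order_total : total R.
Proof.
move=> x y.
have [|m mE minm] := @well_order_min [set x; y]; first by exists x; left.
have Rmx : R m x by apply: minm; left.
have Rmy : R m y by apply: minm; right.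
by case: mE Rmx Rmy => -> // Rx Ry; apply/orP; [left|right].
Qed.

Lemma well_order_refl : reflexive R.
Proof. by move=> x; have := well_order_total x x; rewrite orbb. Qed.

(** Both points are minima of the pair they form, and minima are unique. *)
Lemma well_order_antisym : antisymmetric R.
Proof.
move=> x y /andP[Rxy Ryx].
have /woR[m [_ Um]] : nonempty [pred z | `[< z = x \/ z = y >]].
  by exists x; apply/asboolP; left.
have mx : m = x.
  apply: Um; split; first by apply/asboolP; left.
  by move=> z /asboolP[->|->]; [exact: well_order_refl|].
have my : m = y.
  apply: Um; split; first by apply/asboolP; right.
  by move=> z /asboolP[->|->]; [|exact: well_order_refl].
by rewrite -mx.
Qed.

Lemma well_order_trans : transitive R.
Proof.
move=> y x z Rxy Ryz.
have [|m mE minm] := @well_order_min [set w | [\/ w = x, w = y | w = z]].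
  by exists x; constructor 1.
have Rmx : R m x by apply: minm; constructor 1.
have Rmy : R m y by apply: minm; constructor 2.
have Rmz : R m z by apply: minm; constructor 3.
case: mE Rmx Rmy Rmz => -> // Rx Ry Rz.
  by rewrite (@well_order_antisym x y)// Rxy.
by rewrite -(@well_order_antisym y z)// Ryz.
Qed.

Lemma well_order_asym (x y : T) : ~ R x y -> R y x.
Proof. by case/orP: (well_order_total x y). Qed.

End WellOrder.

Lemma rel_supset_antisym (Z : Type) : antisymmetric (@rel_supset Z).
Proof. by move=> U V /andP[/asboolP VU /asboolP UV]; apply/seteqP. Qed.

(** * Spokes at a point of an arbitrary space *)

Section Spokes.
Context {Z : topologicalType} {z : Z}.

(** Among the members of a nonempty subfamily, one with the least index contains all others, so [F]
    need not be injective. *)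
Lemma is_spoke_image (S : set Z) (J : Type) (R : rel J) (E : set J)
    (F : J -> set Z) :
    S z -> wo_chain R (mem E) ->
    {in E &, forall i j, R i j -> F j `<=` F i} ->
    (forall i, E i -> subspace_nbhs S z (F i)) ->
    (forall U, nbhs z U -> exists2 i, E i & F i `<=` U) ->
  is_spoke z S.
Proof.
move=> Sz woR Fanti Fnbhs Fbase; split=> //; exists (F @` E).
  split=> [_ [i Ei <-]|_ [U zU <-]]; first exact: Fnbhs.
  have [i Ei FU] := Fbase _ zU; exists (F i); first by exists i.
  have [V _ FE] := Fnbhs i Ei.
  by move=> x Fx; split; [move: Fx; rewrite -FE => -[]|exact: FU].
apply: antisymmetric_wo_chain => [U V _ _|A AF [U AU]].
  exact: rel_supset_antisym.
have := AF _ AU; rewrite inE => -[i0 Ei0 i0U].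
have [||i [[/andP[Ei Ai] mini] _]] := woR [pred i | (i \in E) && (F i \in A)].
- by move=> i /andP[].
- by exists i0; rewrite inE/= i0U AU andbT inE.
exists (F i); split=> // V AV; have := AF _ AV.
rewrite inE => -[j Ej jV]; apply/asboolP; rewrite -jV.
by apply: Fanti => //; rewrite ?inE//; apply: mini; rewrite inE/= jV AV andbT inE.
Qed.

Lemma is_spokeS (S T : set Z) : T z -> T `<=` S -> is_spoke z S -> is_spoke z T.
Proof.
move=> Tz TS [_ [B [Bnbhs Bbase] woB]].
apply: (@is_spoke_image _ _ (@rel_supset Z) B (setI T)) => //.
- by move=> U V _ _ /asboolP; exact: setIS.
- move=> W BW; have [U zU <-] := Bnbhs W BW; exists U => //.
  by rewrite setIA (setIidl TS).
- move=> U zU; have [|W BW WSU] := Bbase (S `&` U); first by exists U.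
  by exists W => // x [_ /WSU[]].
Qed.

(** The well-ordered base itself indexes the net: [W] is sent to a chosen point of [A] in [W], and
    later values stay in [W]. *)
Lemma is_spoke_radial (S A : set Z) : is_spoke z S -> closure (S `&` A) z ->
  exists (I : Type) (R : rel I) (u : I -> Z),
    [/\ [set: I] !=set0, well_order R, forall i, A (u i) & u @ tails R --> z].
Proof.
move=> [Sz [B [Bnbhs Bbase] woB]] clSA.
have meetA (W : {W | B W}) : exists x, (sval W `&` A) x.
  case: W => W BW /=; have [U zU <-] := Bnbhs W BW.
  by have [x [[Sx Ax] Ux]] := clSA _ zU; exists x.
have [u uP] := choice meetA.
exists {W | B W}, (fun W1 W2 => rel_supset (sval W1) (sval W2)), u.
split=> [|||U zU].
- have [|W BW _] := Bbase (S `&` setT); first by exists setT => //; exact: filterT.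
  by exists (exist _ W BW).
- apply: antisymmetric_well_order => [[U BU] [V BV]|A' [[W0 BW0] AW0]].
    by move=> /rel_supset_antisym /= UV; exact: eq_exist.
  have [W|| W [[/asboolP[BW AW] minW] _]] :=
      woB [pred W | `[< exists BW : B W, exist _ W BW \in A' >]].
  + by move=> /asboolP[BW _]; rewrite inE.
  + by exists W0; apply/asboolP; exists BW0.
  exists (exist _ W BW); split=> // -[V BV] AV.
  by apply: minW; apply/asboolP; exists BV.
- by move=> W; have [] := uP W.
have [|W BW WSU] := Bbase (S `&` U); first by exists U.
exists (exist _ W BW) => // V /asboolP /= VW; apply: (proj2 (WSU _ _)).
by apply: VW; have [] := uP V.
Qed.

End Spokes.

(** * Neighbourhoods of infinity and relatively compact sets *)

Section Infinity.
Context {X : topologicalType}.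
Implicit Types (A K S W : set X).

Lemma precompactU A K : precompact A -> precompact K -> precompact (A `|` K).
Proof. by rewrite !precompactE closureU; exact: compactU. Qed.

Lemma nbhs_infty (K : set X) (U : set (one_point_compactification X)) :
  precompact K -> U (infty X) -> (forall x, ~ K x -> U (Some x)) ->
  nbhs (infty X) U.
Proof.
move=> [L KL cL] Uoo KU; exists L => // _ [[x Lx <-]|->] //.
by apply: KU => /KL.
Qed.

Lemma nbhs_infty_precompact (U : set (one_point_compactification X)) :
  nbhs (infty X) U -> precompact (~` [set x | U (Some x)]).
Proof.
move=> [L cL LU]; exists L => // x; apply: contra_notP => Lx; apply: LU.
by left; exists x.
Qed.

Lemma closure_infty A :
  closure [set (Some x : one_point_compactification X) | x in A] (infty X) <->
  ~ precompact A.
Proof.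
split=> [clA pA|npA U ooU].
  have [|_ [[x Ax <-]]] := clA (~` (Some @` A)); last by apply; exists x.
  apply: (nbhs_infty pA) => [[]//|x Ax [y Ay [yx]]].
  by apply: Ax; rewrite -yx.
apply: contrapT => AU0; apply: npA.
apply: precompact_subset (nbhs_infty_precompact ooU) => x Ax Ux.
by apply: AU0; exists (Some x); split=> //; exists x.
Qed.

Hypotheses (lcX : locally_compact [set: X]) (hX : hausdorff_space X).

(** The one-point compactification is compact Hausdorff, hence regular. *)
Lemma nbhs_infty_closed (U : set (one_point_compactification X)) :
  nbhs (infty X) U ->
  exists W, [/\ closed W, precompact (~` W) & forall x, W x -> U (Some x)].
Proof.
move=> ooU.
have hoX := one_point_compactification_hausdorff lcX hX.
have [V ooV VU] := compact_regular hoX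
  one_point_compactification_compact filterT ooU.
exists [set x | closure V (Some x)]; split=> [||x /VU//].
  have /continuous_closedP/(_ (closure V)) :=
    @one_point_compactification_some_continuous X.
  by apply; exact: closed_closure.
apply: nbhs_infty_precompact; apply: filterS ooV; exact: subset_closure.
Qed.

Lemma precompact_closure A : precompact A -> precompact (closure A).
Proof.
by rewrite (precompact_closed (@closed_closure _ A)) precompactE.
Qed.

(* [B] is the shortest initial segment of [A] that is not relatively compact;
   minimality replaces the usual choice of a subset of least cardinality. *)
Lemma minimal_initial_segment A (R : rel X) : well_order R -> ~ precompact A ->
  exists B, [/\ B `<=` A, ~ precompact B
    & forall b, B b -> precompact [set x | B x /\ R x b]].
Proof.
move=> woR npA; pose head a := [set x | A x /\ R x a].
have [[a0 npa0]|allp] := pselect (exists a, ~ precompact (head a)); last first.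
  exists A; split=> // b _; apply: contrapT => npb; apply: allp.
  by exists b.
have [|m npm minm] := @well_order_min _ _ woR [set a | ~ precompact (head a)].
  by exists a0.
exists [set x | A x /\ ~ R m x]; split=> [x []//|pB|b [Ab mb]].
  (* Adding the single point [m] to the strict segment below it recovers [head m]. *)
  have := precompactU pB (compact_precompact hX (@compact_set1 _ m)).
  apply: contra_not npm; apply: precompact_subset.
  move=> x [Ax Rxm]; have [Rmx|nRmx] := pselect (R m x); last by left.
  by right; apply: (well_order_antisym woR); rewrite Rxm.
apply: (@precompact_subset _ _ (head b)); first by move=> x [[Ax _] Rxb].
by apply: contrapT => /minm.
Qed.

(** * From transfinite sequences to closed spokes *)

Lemma sequence_at_infty A : radial_at (infty X) -> ~ precompact A ->
  exists (I : Type) (RI : rel I) (u : I -> X),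
    [/\ well_order RI, forall i, A (u i)
      & forall K, precompact K -> exists i, forall j, RI i j -> ~ K (u j)].
Proof.
move=> radX /closure_infty /radX[I [RI [u [_ woRI Au uoo]]]].
have /choice[u' u'P] i : exists x, A x /\ Some x = u i.
  by have [x Ax xu] := Au i; exists x.
exists I, RI, u'; split=> // [i|K pK]; first by have [] := u'P i.
have [|i _ iK] := uoo (~` [set Some x | x in K]).
  by apply: (nbhs_infty pK) => [[]//|x Kx [y Ky [yx]]]; apply: Kx; rewrite -yx.
exists i => j /iK /= nK Kj; apply: nK; exists (u' j) => //.
by have [] := u'P j.
Qed.

Lemma interlaced_subset (B : set X) (R : rel X) (v : X -> X) : well_order R ->
  (forall b, B b -> B (v b) /\ ~ R (v b) b) ->
  exists E, [/\ E `<=` B,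
    forall e e', E e -> E e' -> ~ R e' e -> R (v e) e'
    & forall b, B b -> exists2 e, E e & R b e].
Proof.
move=> woR vP.
pose P := [set E | E `<=` B /\
  forall e e', E e -> E e' -> ~ R e' e -> R (v e) e'].
have [F FP Ftot|E [[EB Ev] maxE]] := @Zorn_bigcup _ P.
  split=> [x [E /FP[EB _]]|e e' [E1 F1 E1e] [E2 F2 E2e']]; first exact: EB.
  have [E12|E21] := Ftot _ _ F1 F2.
    by have [_] := FP _ F2; apply => //; exact: E12.
  by have [_] := FP _ F1; apply => //; exact: E21.
exists E; split=> // b Bb; apply: contrapT => nEb.
have ltb e : E e -> ~ R b e by move=> Ee be; apply: nEb; exists e.
(* An upper bound [c >= b] of [v @` E] could be added to [E]. *)
have absurd c : B c -> R b c -> (forall e, E e -> R (v e) c) -> False.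
  move=> Bc bc vc.
  have nEc : ~ E c by move=> /ltb.
  have Rec e : E e -> R e c.
    move=> /ltb nbe; apply: (well_order_trans woR _ bc).
    exact: (well_order_asym woR).
  apply: (maxE (E `|` [set c])).
    split; first by move=> x; left.
    by move=> /(_ c (or_intror erefl)).
  split=> [x [/EB//|->//]|e e' [Ee|->] [Ee'|->]].
  - exact: Ev.
  - by move=> _; exact: vc.
  - by move=> nR; case: nR; exact: Rec.
  - by rewrite (well_order_refl woR).
(* If [v e] lies above [b], then [e] is the last element of [E], since a later [e'] would satisfy
   [b <= v e <= e']; so [v e] serves as [c]. Otherwise [b] does. *)
have [[e [Ee nve]]|allv] := pselect (exists e, E e /\ ~ R (v e) b).
  have [Bve nve'] := vP e (EB e Ee).
  apply: (absurd (v e)) => //; first exact: (well_order_asym woR).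
  move=> e' Ee'.
  have [Ree'|nRee'] := pselect (R e e').
    have [Re'e|nRe'e] := pselect (R e' e).
      have <- : e = e' by apply: (well_order_antisym woR); rewrite Ree'.
      exact: (well_order_refl woR).
    case: (ltb _ Ee'); apply: (well_order_trans woR _ (Ev _ _ Ee Ee' nRe'e)).
    exact: (well_order_asym woR).
  apply: (well_order_trans woR (Ev _ _ Ee' Ee nRee')).
  exact: (well_order_asym woR).
apply: (absurd b) => // [|e Ee]; first exact: (well_order_refl woR).
by apply: contrapT => nve; apply: allv; exists e.
Qed.

Lemma closure_spoke (E : set X) (R : rel X) (v : X -> X) : well_order R ->
  (forall e, E e -> precompact [set v e' | e' in [set e' | E e' /\ ~ R e e']]) ->
  (forall K, precompact K ->
    exists2 e, E e & forall e', E e' -> R e e' -> ~ K (v e')) ->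
  spoke_at_infty (closure [set v e | e in E]).
Proof.
move=> woR phead vtail.
pose tail e := [set v e' | e' in [set e' | E e' /\ R e e']].
apply: (@is_spoke_image _ _ _ _ R E (fun e =>
  [set (Some x : one_point_compactification X) | x in closure (tail e)]
    `|` [set infty X])).
- by right.
- by move=> A _; exact: woR.
- move=> e1 e2 _ _ R12; apply: setSU; apply: image_subset; apply: closureS.
  apply: image_subset => e' [Ee' Re']; split=> //.
  exact: (well_order_trans woR R12).
(* Removing the relatively compact closure of the head leaves a neighbourhood of infinity; the
   closed tail is put back so that the trace is exactly the closed tail. *)
- move=> e Ee; exists (Some @` closure (tail e) `|`
      Some @` (~` closure [set v e' | e' in [set e' | E e' /\ ~ R e e']]) `|`
      [set infty X]).
    apply: (@nbhs_infty (closure [set v e' | e' in [set e' | E e' /\ ~ R e e']])).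
    + exact: precompact_closure (phead e Ee).
    + by right.
    + by move=> x nx; left; right; exists x.
  have vE : [set v e | e in E] =
      [set v e' | e' in [set e' | E e' /\ ~ R e e']] `|` tail e.
    apply/seteqP; split=> [_ [e' Ee' <-]|_ [[e' [Ee' _] <-]|[e' [Ee' _] <-]]].
    + by have [?|?] := pselect (R e e'); [right|left]; exists e'.
    + by exists e'.
    + by exists e'.
  rewrite vE closureU; apply/seteqP; split=> [x|x [[y yt <-]|->]].
  + move=> [[[y yS <-]|->]]; last by right.
    case=> [[[z zt [<-]]|[z znh [zy]]]|//]; first by left; exists z.
    by case: yS => [yh|yt]; [case: znh; rewrite zy|left; exists y].
  + by split; [left; exists y => //; right|left; left; exists y].
  + by split; right.
(* A closed [W] contains the closure of any tail that it contains. *)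
- move=> U ooU; have [W [clW pW WU]] := nbhs_infty_closed ooU.
  have [e Ee eW] := vtail _ pW; exists e => // _ [[x xt <-]|->].
    apply: WU; apply: clW; apply: closureS xt => _ [e' [Ee' Ree'] <-].
    by apply: contrapT => /(eW _ Ee' Ree').
  exact: (nbhs_singleton ooU).
Qed.

Lemma radial_closed_spoke A : radial_at (infty X) -> ~ precompact A ->
  exists2 S, closed_spokes_at_infty X S & ~ precompact (S `&` A).
Proof.
move=> radX npA; have [R woR] := well_ordering_principle X.
have [B [BA npB phead]] := minimal_initial_segment woR npA.
have [I [RI [u [woRI Bu ucvg]]]] := sequence_at_infty radX npB.
pose above b i := forall j, RI i j -> ~ R (u j) b.
have /choice[s sP] b : exists i, B b ->
    above b i /\ forall i', above b i' -> RI i i'.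
  (* Outside [B] the index is an arbitrary default. *)
  have [Bb|nBb] := pselect (B b); last first.
    by have [i _] := ucvg _ (compact_precompact hX compact0); exists i.
  have [|i ib mini] := @well_order_min _ _ woRI (above b).
    have [i ib] := ucvg _ (phead b Bb); exists i => j /ib nR Rj; exact: nR.
  by exists i.
pose v b := u (s b).
have vgt b : B b -> B (v b) /\ ~ R (v b) b.
  move=> Bb; split; first exact: Bu.
  by have [+ _] := sP b Bb; apply; exact: (well_order_refl woRI).
have [E [EB Ev Ecof]] := interlaced_subset woR vgt.
have vcvg K : precompact K ->
    exists2 e, E e & forall e', E e' -> R e e' -> ~ K (v e').
  move=> /ucvg[i iK].
  have [b [Bb ib]] : exists b, B b /\ RI i (s b).
    (* From [s (u i)] on, [u] stays above [u i], so this index cannot precede [i]. *)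
    exists (u i); split; first exact: Bu.
    apply: (well_order_asym woRI) => si.
    have [/(_ _ si) + _] := sP (u i) (Bu i).
    by rewrite (well_order_refl woR).
  have [e Ee be] := Ecof b Bb; exists e => // e' Ee' ee'; apply: iK.
  apply: (well_order_trans woRI ib).
  (* [s] is monotone: staying above [e'] implies staying above [b]. *)
  have [_] := sP b Bb; apply => j sj Rjb.
  have [/(_ _ sj) + _] := sP e' (EB _ Ee'); apply.
  exact: (well_order_trans woR Rjb (well_order_trans woR be ee')).
exists (closure (v @` E)).
  split; last exact: closed_closure.
  apply: closure_spoke woR _ vcvg => e Ee.
  apply: precompact_subset (phead e (EB e Ee)) => _ [e' [Ee' nR] <-].
  by split; [exact: Bu|exact: Ev].
(* All values of [v] on [E] lie in both sets, so they cannot leave the intersection. *)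
move=> /vcvg[e Ee] /(_ e Ee (well_order_refl woR e)); apply; split.
  by apply: subset_closure; exists e.
by apply: BA; exact: Bu.
Qed.

Lemma closed_spokes_missing_cofinal A :
  (forall S, closed_spokes_at_infty X S -> precompact (S `&` A)) ->
  cofinal_spokes [set S | closed_spokes_at_infty X S /\ S `&` A = set0].
Proof.
move=> pA; split=> [S []//|S spS].
have [|W [clW pW Wcl]] :=
    @nbhs_infty_closed (~` [set Some x | x in closure (S `&` A)]).
  apply: (nbhs_infty (precompact_closure (pA _ spS))) => [[]//|x nx [y + [yx]]].
  by rewrite yx.
have [[Soo spokeS] clS] := spS.
exists (S `&` W).
  split; [split; [|exact: closedI]|].
    apply: is_spokeS spS.1; first by right.
    by apply: setSU; apply: image_subset => x [].
  rewrite -subset0 => x [[Sx Wx] Ax]; apply: (Wcl x Wx).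
  by exists x => //; exact: subset_closure.
rewrite /spoke_le -precompactE; apply: precompact_subset pW.
by move=> x [Sx nSW] Wx; apply: nSW.
Qed.

End Infinity.

Theorem theorem2p9 (X : topologicalType)
    (lcX : locally_compact [set: X])
    (ncX : ~ compact [set: X])
    (hX : hausdorff_space X) :
  radial_at (infty X) <->
  (forall C : set (set X), cofinal_spokes C ->
     co_compact (interior (\bigcup_(S in C) S))).
Proof.
split=> [radX C [_ Ccof]|Cint A clA].
  rewrite /co_compact -closure_setC -precompactE; apply: contrapT => npA.
  have [S spS npS] := radial_closed_spoke lcX hX radX npA.
  (* Points of [S] outside the union of [C] lie in particular outside [T]. *)
  have [T CT] := Ccof S spS; rewrite /spoke_le -precompactE => pST.
  apply: npS; apply: precompact_subset pST => x [Sx nx].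
  by split=> // Tx; apply: nx; exists T.
have [Aoo|nAoo] := pselect (A (infty X)).
  (* A one-term net suffices here. *)
  exists unit, (fun _ _ => true), (fun _ => infty X).
  split=> // [||U ooU]; first by exists tt.
    apply: antisymmetric_well_order => [[] []//|P [[] P0]].
    by exists tt; split=> // -[].
  by exists tt => // i _; exact: nbhs_singleton.
pose A' : set X := [set x | A (Some x)].
have AE : A = [set Some x | x in A'].
  apply/seteqP; split=> [[x Ax|//]|_ [x Ax <-]//]; by exists x.
have npA' : ~ precompact A' by apply/closure_infty; rewrite -AE.
have [[S [spS npSA]]|allp] := pselect (exists S,
    closed_spokes_at_infty X S /\ ~ precompact (S `&` A')).
  apply: is_spoke_radial spS.1 _.
  have /closure_infty := npSA; apply: closureS => _ [x [Sx Ax] <-].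
  by split=> //; left; exists x.
have /closed_spokes_missing_cofinal - /(_ lcX hX)/Cint : forall S,
    closed_spokes_at_infty X S -> precompact (S `&` A').
  by move=> S spS; apply: contrapT => npSA; apply: allp; exists S.
rewrite /co_compact -closure_setC -precompactE => pC; case: npA'.
apply: precompact_subset pC => x Ax [S [_ SA0] Sx].
by have : (S `&` A') x by []; rewrite SA0.
Qed.
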